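(* Let $T$ be a complete theory with monster model $\mathcal{U}$, $M\prec\mathcal{U}$ a small elementary submodel, $\mu\in\mathfrak{M}_x(\mathcal{U})$, $\nu\in\mathfrak{M}_y(\mathcal{U})$. If $\mu$ is finitely satisfiable in $M$ and $\mu\geq_{\mathbb{E},M}\nu$, then $\nu$ is finitely satisfiable in $M$. Moreover, if $\mu$ is finitely satisfiable and $\mu\geq_{\mathbb{E}}\nu$, then $\nu$ is finitely satisfiable.
   Context: For $C\subseteq\mathcal{U}$, $\mathcal{L}_x(C)$ is the Boolean algebra of formulas in $x$ with parameters from $C$ modulo $T$, embedded in $\mathcal{L}_{xy}(C)$ via $\varphi(x)\mapsto\varphi(x)\wedge y=y$; $\mathfrak{M}_x(C)$ is the set of finitely additive probability measures on $\mathcal{L}_x(C)$. For $\omega\in\mathfrak{M}_{xy}(C)$, $\pi_x(\omega)(\varphi(x))=\omega(\varphi(x)\wedge y=y)$ (similarly $\pi_y$); $\omega|_D$ is restriction. For small $A$, $\mu\geq_{\mathbb{E},A}\nu$ means there is $\lambda\in\mathfrak{M}_{xy}(A)$ with $\pi_x(\lambda)=\mu|_A$ such that every $\omega\in\mathfrak{M}_{xy}(\mathcal{U})$ with $\omega|_A=\lambda$ and $\pi_x(\omega)=\mu$ satisfies $\pi_y(\omega)=\nu$; $\mu\geq_{\mathbb{E}}\nu$ means this for some small $A$. A global measure $\mu$ is finitely satisfiable in $M$ if every $\varphi(x)\in\mathcal{L}_x(\mathcal{U})$ with $\mu(\varphi(x))>0$ is realized by some tuple from $M$; it is finitely satisfiable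 if finitely satisfiable in some small $M\prec\mathcal{U}$. *)

(* Defs.v *)
From mathcomp Require Import all_boot.
From Stdlib Require Import Reals List.

Set Implicit Arguments.
Unset Strict Implicit.
Unset Printing Implicit Defensive.

Record language := Language {
  Fsym : Type; Rsym : Type;
  farity : Fsym -> nat; rarity : Rsym -> nat }.

Inductive term (L : language) : Type :=
| tvar : nat -> term L
| tapp : forall f : Fsym L, ('I_(@farity L f) -> term L) -> term L.

(* de Bruijn: fex binds variable 0 and shifts the others *)
Inductive formula (L : language) : Type :=
| feq : term L -> term L -> formula L
| frel : forall r : Rsym L, ('I_(@rarity L r) -> term L) -> formula L
| fneg : formula L -> formula L
| fand : formula L -> formula L -> formula L
| fex : formula L -> formula L.

Arguments tvar {L}.
Arguments feq {L}.
Arguments fneg {L}.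
Arguments fand {L}.
Arguments fex {L}.

Record structure (L : language) := Structure {
  carrier :> Type;
  dflt : carrier;
  finterp : forall f : Fsym L, ('I_(@farity L f) -> carrier) -> carrier;
  rinterp : forall r : Rsym L, ('I_(@rarity L r) -> carrier) -> Prop }.
Arguments dflt {L} s : rename.
Arguments finterp {L} s f _ : rename.
Arguments rinterp {L} s r _ : rename.

Fixpoint teval (L : language) (S : structure L) (e : nat -> S) (t : term L) : S :=
  match t with
  | tvar i => e i
  | tapp f ts => finterp S f (fun i => teval e (ts i))
  end.
Arguments teval {L} S e t.

Definition scons (X : Type) (u : X) (e : nat -> X) : nat -> X :=
  fun i => match i with 0 => u | k.+1 => e k end.

Fixpoint sat (L : language) (S : structure L) (e : nat -> S) (phi : formula L) : Prop :=
  match phi with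
  | feq t1 t2 => teval S e t1 = teval S e t2
  | frel r ts => rinterp S r (fun i => teval S e (ts i))
  | fneg p => ~ sat e p
  | fand p q => sat e p /\ sat e q
  | fex p => exists u : S, sat (scons u e) p
  end.
Arguments sat {L} S e phi.

Fixpoint tfv_lt (L : language) (m : nat) (t : term L) : Prop :=
  match t with
  | tvar i => (i < m)%N
  | tapp f ts => forall i, tfv_lt m (ts i)
  end.

Fixpoint ffv_lt (L : language) (m : nat) (phi : formula L) : Prop :=
  match phi with
  | feq t1 t2 => tfv_lt m t1 /\ tfv_lt m t2
  | frel r ts => forall i, tfv_lt m (ts i)
  | fneg p => ffv_lt m p
  | fand p q => ffv_lt m p /\ ffv_lt m q
  | fex p => ffv_lt m.+1 p
  end.

(* environment: variables 0..n-1 := the tuple a (the variables x),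
   variables n..n+k-1 := the parameters c, the rest irrelevant *)
Definition env (L : language) (S : structure L) (n k : nat)
  (a : 'I_n -> S) (c : 'I_k -> S) : nat -> S :=
  fun i => match (insub i : option 'I_n) with
           | Some j => a j
           | None => match (insub (i - n) : option 'I_k) with
                     | Some j => c j
                     | None => dflt S
                     end
           end.

Definition definable (L : language) (S : structure L) (C : S -> Prop) (n : nat)
  (D : ('I_n -> S) -> Prop) : Prop :=
  exists (k : nat) (c : 'I_k -> S) (phi : formula L),
    (forall i, C (c i)) /\ ffv_lt (n + k) phi /\
    (forall a, D a <-> sat S (env a c) phi).

Definition allS (L : language) (S : structure L) : S -> Prop := fun _ => True.
Arguments allS {L} S _.

(* A measure is given as a set function; only its values on C-definable
   sets matter (all comparisons below are restricted to definable sets). *)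
Definition is_kmeasure (L : language) (S : structure L) (C : S -> Prop) (n : nat)
  (mu : (('I_n -> S) -> Prop) -> R) : Prop :=
  mu (fun _ => True) = 1%R /\
  (forall D, definable C D -> (0 <= mu D)%R) /\
  (forall D E, definable C D -> definable C E ->
     (forall a, ~ (D a /\ E a)) ->
     mu (fun a => D a \/ E a) = (mu D + mu E)%R).

Definition xpart (X : Type) (n m : nat) (a : 'I_(n + m) -> X) : 'I_n -> X :=
  fun i => a (lshift m i).
Definition ypart (X : Type) (n m : nat) (a : 'I_(n + m) -> X) : 'I_m -> X :=
  fun j => a (rshift n j).
Definition embx (X : Type) (n m : nat) (D : ('I_n -> X) -> Prop) :
  ('I_(n + m) -> X) -> Prop := fun a => D (xpart a).
Definition emby (X : Type) (n m : nat) (D : ('I_m -> X) -> Prop) :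
  ('I_(n + m) -> X) -> Prop := fun a => D (ypart a).
Arguments embx {X n} m D _.
Arguments emby {X} n {m} D _.

Definition card_le (A B : Type) : Prop := exists f : A -> B, injective f.
Definition card_lt (A B : Type) : Prop := card_le A B /\ ~ card_le B A.
Definition small (L : language) (S : structure L) (K : Type) (A : S -> Prop) : Prop :=
  card_lt {x : S | A x} K.

Definition fclosed (L : language) (S : structure L) (M : S -> Prop) : Prop :=
  forall f (args : 'I_(@farity L f) -> S), (forall i, M (args i)) -> M (finterp S f args).

Definition substructure (L : language) (S : structure L) (M : S -> Prop)
  (m0 : S) (h0 : M m0) (hcl : fclosed M) : structure L :=
  @Structure L {x : S | M x} (exist _ m0 h0)
    (fun f args => exist _ (finterp S f (fun i => proj1_sig (args i)))
                          (hcl f _ (fun i => proj2_sig (args i))))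
    (fun r args => rinterp S r (fun i => proj1_sig (args i))).

Definition elem_sub (L : language) (S : structure L) (M : S -> Prop) : Prop :=
  exists (m0 : S) (h0 : M m0) (hcl : fclosed M),
    forall (phi : formula L) (e : nat -> substructure h0 hcl),
      sat (substructure h0 hcl) e phi <-> sat S (fun i => proj1_sig (e i)) phi.

Definition saturated (L : language) (S : structure L) (K : Type) : Prop :=
  forall A : S -> Prop, small K A ->
  forall P : (('I_1 -> S) -> Prop) -> Prop,
    (forall D, P D -> definable A D) ->
    (forall l : list (('I_1 -> S) -> Prop),
        (forall D, List.In D l -> P D) -> exists a, forall D, List.In D l -> D a) ->
    exists a, forall D, P D -> D a.

Definition automorphism (L : language) (S : structure L) (s : S -> S) : Prop :=
  bijective s /\
  (forall f args, s (finterp S f args) = finterp S f (fun i => s (args i))) /\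
  (forall r args, rinterp S r args <-> rinterp S r (fun i => s (args i))).

Definition strongly_homogeneous (L : language) (S : structure L) (K : Type) : Prop :=
  forall (A : S -> Prop), small K A ->
  forall f : S -> S,
    (forall (phi : formula L) (e : nat -> S), (forall i, A (e i)) ->
       (sat S e phi <-> sat S (fun i => f (e i)) phi)) ->
    exists s : S -> S, automorphism s /\ forall a, A a -> s a = f a.

(* U is a monster model of T := Th(U), for the cardinal K > |T| *)
Definition monster (L : language) (U : structure L) (K : Type) : Prop :=
  card_lt (nat + (Fsym L + Rsym L))%type K /\
  saturated U K /\ strongly_homogeneous U K.

Definition fin_sat_in (L : language) (U : structure L) (n : nat)
  (mu : (('I_n -> U) -> Prop) -> R) (M : U -> Prop) : Prop :=
  forall D, definable (allS U) D -> (0 < mu D)%R ->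
    exists a : 'I_n -> U, (forall i, M (a i)) /\ D a.

Definition fin_sat (L : language) (U : structure L) (K : Type) (n : nat)
  (mu : (('I_n -> U) -> Prop) -> R) : Prop :=
  exists M : U -> Prop, small K M /\ elem_sub M /\ fin_sat_in mu M.

Definition geE_at (L : language) (U : structure L) (A : U -> Prop) (n m : nat)
  (mu : (('I_n -> U) -> Prop) -> R) (nu : (('I_m -> U) -> Prop) -> R) : Prop :=
  exists lam : (('I_(n + m) -> U) -> Prop) -> R,
    is_kmeasure A lam /\
    (forall D, definable A D -> lam (embx m D) = mu D) /\
    (forall om : (('I_(n + m) -> U) -> Prop) -> R,
       is_kmeasure (allS U) om ->
       (forall D, definable A D -> om D = lam D) ->
       (forall D, definable (allS U) D -> om (embx m D) = mu D) ->
       forall D, definable (allS U) D -> om (emby n D) = nu D).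

Definition geE (L : language) (U : structure L) (K : Type) (n m : nat)
  (mu : (('I_n -> U) -> Prop) -> R) (nu : (('I_m -> U) -> Prop) -> R) : Prop :=
  exists A : U -> Prop, small K A /\ geE_at A mu nu.

(* Main.v *)
Require Import Defs.
From mathcomp Require Import all_boot zify.
From mathcomp Require boolp classical_sets.
Set Warnings "-notation-overridden".
From Stdlib Require Import Reals Lra Classical ClassicalEpsilon.

(** Let lam over A witness that mu dominates nu, let A be contained in M, and let mu be
    finitely satisfiable in M. It suffices to find a global measure omega that
    extends lam, projects to mu, and is finitely satisfiable in M: its y-projection
    is nu. Restrict to tuples from M: there lam and mu live on two algebras of sets,
    and a common extension to all subsets is a coherent price system in the
    sense of de Finetti, which exists (Zorn) once f(x,y) + g(x) >= 0 on M, for f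
    A-definable simple and g simple, implies int f dlam + int g dmu >= 0. Replacing f by
    h(x) = min_y f(x,y), which is again A-definable, reduces this to mu alone;
    the minimum over y in M is the one over y in U because M is elementary.
    For the second claim, Lowenheim-Skolem gives a small M containing A and the
    model in which mu is finitely satisfiable; its smallness needs that an infinite
    set is equipotent with the set of finite sequences of its elements. *)

(** * Definable sets *)

Definition up_ren (r : nat -> nat) : nat -> nat :=
  fun i => if i is k.+1 then (r k).+1 else 0.

Fixpoint tren {L : language} (r : nat -> nat) (t : term L) : term L :=
  match t with
  | tvar i => tvar (r i)
  | tapp f ts => tapp (fun i => tren r (ts i))
  end.

Fixpoint fren {L : language} (r : nat -> nat) (phi : formula L) : formula L :=
  match phi with
  | feq t1 t2 => feq (tren r t1) (tren r t2)
  | Defs.frel R ts => Defs.frel (fun i => tren r (ts i))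
  | fneg p => fneg (fren r p)
  | fand p q => fand (fren r p) (fren r q)
  | fex p => fex (fren (up_ren r) p)
  end.

Lemma teval_eq_in {L : language} (S : structure L) (N : nat) (t : term L)
    (e e' : nat -> S) :
  tfv_lt N t -> (forall i, (i < N)%N -> e i = e' i) -> teval S e t = teval S e' t.
Proof.
move=> + he; elim: t => [i|f ts IH] /= ht; first exact: he.
by congr (finterp S f _); apply: boolp.funext => i; exact: IH.
Qed.

Lemma sat_eq_in {L : language} (S : structure L) (phi : formula L) (N : nat)
    (e e' : nat -> S) :
  ffv_lt N phi -> (forall i, (i < N)%N -> e i = e' i) -> (sat S e phi <-> sat S e' phi).
Proof.
elim: phi N e e' => [t1 t2|R ts|p IH|p IHp q IHq|p IH] N e e' /=.
- by move=> [h1 h2] he; rewrite (teval_eq_in S N t1 e e') ?(teval_eq_in S N t2 e e').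
- move=> h he; suff -> : (fun i => teval S e (ts i)) = (fun i => teval S e' (ts i)) by [].
  by apply: boolp.funext => i; exact: teval_eq_in (h i) he.
- by move=> h he; have := IH _ _ _ h he; tauto.
- by move=> [h1 h2] he; have := IHp _ _ _ h1 he; have := IHq _ _ _ h2 he; tauto.
- move=> h he; have H u : sat S (scons u e) p <-> sat S (scons u e') p.
    by apply: (IH N.+1) => // -[|i] //= hi; exact: he.
  by split=> -[u /H hu]; exists u.
Qed.

Lemma teval_tren {L : language} (S : structure L) (r : nat -> nat) (t : term L)
    (e : nat -> S) :
  teval S e (tren r t) = teval S (fun i => e (r i)) t.
Proof.
elim: t => [i|f ts IH] //=; congr (finterp S f _).
by apply: boolp.funext => i; exact: IH.
Qed.

Lemma sat_fren {L : language} (S : structure L) (phi : formula L) (r : nat -> nat)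
    (e : nat -> S) :
  sat S e (fren r phi) <-> sat S (fun i => e (r i)) phi.
Proof.
elim: phi r e => [t1 t2|R ts|p IH|p IHp q IHq|p IH] r e /=.
- by rewrite !teval_tren.
- suff -> : (fun i => teval S e (tren r (ts i)))
      = (fun i => teval S (fun i => e (r i)) (ts i)) by [].
  by apply: boolp.funext => i; exact: teval_tren.
- by have := IH r e; tauto.
- by have := IHp r e; have := IHq r e; tauto.
- have H u : sat S (scons u e) (fren (up_ren r) p)
      <-> sat S (scons u (fun i => e (r i))) p.
    rewrite IH; suff -> : (fun i => scons u e (up_ren r i))
      = scons u (fun i => e (r i)) by [].
    by apply: boolp.funext => -[].
  by split=> -[u /H hu]; exists u.
Qed.

Lemma tfv_lt_tren {L : language} (N N' : nat) (r : nat -> nat) (t : term L) :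
  (forall i, (i < N)%N -> (r i < N')%N) -> tfv_lt N t -> tfv_lt N' (tren r t).
Proof. by move=> hr; elim: t => [i|f ts IH] /= h; [exact: hr|move=> i; exact: IH]. Qed.

Lemma ffv_lt_fren {L : language} (phi : formula L) (N N' : nat) (r : nat -> nat) :
  (forall i, (i < N)%N -> (r i < N')%N) -> ffv_lt N phi -> ffv_lt N' (fren r phi).
Proof.
elim: phi N N' r => [t1 t2|R ts|p IH|p IHp q IHq|p IH] N N' r hr /=.
- by move=> [h1 h2]; split; apply: (tfv_lt_tren N).
- by move=> h i; exact: (tfv_lt_tren N).
- exact: IH.
- by move=> [h1 h2]; split; [exact: (IHp N)|exact: (IHq N)].
- by apply: (IH N.+1) => -[|i] //= hi; exact: hr.
Qed.

Lemma tfv_lt_le {L : language} (N N' : nat) (t : term L) :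
  (N <= N')%N -> tfv_lt N t -> tfv_lt N' t.
Proof. by move=> hN; elim: t => [i|f ts IH] /= h; [exact: leq_trans hN|move=> i; exact: IH]. Qed.

Lemma ffv_lt_le {L : language} (phi : formula L) (N N' : nat) :
  (N <= N')%N -> ffv_lt N phi -> ffv_lt N' phi.
Proof.
elim: phi N N' => [t1 t2|R ts|p IH|p IHp q IHq|p IH] N N' hN /=.
- by move=> [h1 h2]; split; apply: (tfv_lt_le N).
- by move=> h i; exact: (tfv_lt_le N).
- exact: IH.
- by move=> [h1 h2]; split; [exact: (IHp N)|exact: (IHq N)].
- exact: (IH N.+1).
Qed.

Lemma tfv_lt_ex {L : language} (t : term L) : exists N, tfv_lt N t.
Proof.
elim: t => [i|f ts IH]; first by exists i.+1 => /=.
have [g hg] := boolp.choice IH.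
exists (\max_i g i) => i; apply: tfv_lt_le (hg i); exact: leq_bigmax.
Qed.

Lemma ffv_lt_ex {L : language} (phi : formula L) : exists N, ffv_lt N phi.
Proof.
elim: phi => [t1 t2|R ts|p [N h]|p [N h] q [N' h']|p [N h]].
- have [N h] := tfv_lt_ex t1; have [N' h'] := tfv_lt_ex t2.
  by exists (maxn N N'); split; [apply: tfv_lt_le h|apply: tfv_lt_le h'];
    rewrite ?leq_maxl ?leq_maxr.
- have [g hg] := boolp.choice (fun i => tfv_lt_ex (ts i)).
  exists (\max_i g i) => i; apply: tfv_lt_le (hg i); exact: leq_bigmax.
- by exists N.
- by exists (maxn N N'); split; [apply: ffv_lt_le h|apply: ffv_lt_le h'];
    rewrite ?leq_maxl ?leq_maxr.
- by exists N; apply: ffv_lt_le h.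
Qed.

Lemma sat_iter_fex {L : language} (S : structure L) (m : nat) (psi : formula L)
    (e : nat -> S) :
  sat S e (iter m fex psi) <->
  exists y : nat -> S, sat S (fun i => if (i < m)%N then y i else e (i - m)%N) psi.
Proof.
elim: m e => [|m IH] e.
  have E (y : nat -> S) : (fun i => if (i < 0)%N then y i else e (i - 0)%N) = e.
    by apply: boolp.funext => i; rewrite ltn0 subn0.
  by split=> [h|[y]]; [exists e; rewrite E|rewrite E].
rewrite iterS /=; split.
(* The outermost quantifier of the block binds variable [m], so its witness comes last. *)
- move=> [u /IH [y h]]; exists (fun i => if (i == m)%N then u else y i).
  rewrite (_ : (fun i => _) =
    (fun i => if (i < m)%N then y i else scons u e (i - m)%N)) //.
  apply: boolp.funext => i; rewrite ltnS leq_eqVlt; case: eqP => [->|ne] /=.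
    by rewrite ltnn subnn.
  case: ltnP => // hi; have -> : (i - m = (i - m.+1).+1)%N by lia.
  by [].
- move=> [y h]; exists (y m); apply/IH; exists y.
  rewrite (_ : (fun i => _) =
    (fun i => if (i < m.+1)%N then y i else e (i - m.+1)%N)) //.
  apply: boolp.funext => i; rewrite ltnS (leq_eqVlt i m); case: eqP => [->|ne] /=.
    by rewrite ltnn subnn.
  case: ltnP => // hi; have -> : (i - m = (i - m.+1).+1)%N by lia.
  by [].
Qed.

Lemma ffv_lt_iter_fex {L : language} (m N : nat) (psi : formula L) :
  ffv_lt (m + N) psi -> ffv_lt N (iter m fex psi).
Proof. by elim: m N => [|m IH] N //= h; apply: IH; rewrite addnS. Qed.

Lemma env_lt {L : language} (S : structure L) (n k : nat) (a : 'I_n -> S)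
    (c : 'I_k -> S) (j : 'I_n) : env a c j = a j.
Proof. by rewrite /env insubT //= => h; congr a; exact: val_inj. Qed.

Lemma env_ge {L : language} (S : structure L) (n k : nat) (a : 'I_n -> S)
    (c : 'I_k -> S) (j : 'I_k) : env a c (n + j) = c j.
Proof.
rewrite /env insubF; last by apply/negP; lia.
by rewrite addKn insubT //= => h; congr c; exact: val_inj.
Qed.

(** A case view: it splits an index below [n + k] into the two shapes on which [env_lt] and [env_ge]
    rewrite. *)
Variant env_spec (n k : nat) : nat -> Prop :=
| EnvVar (j : 'I_n) : env_spec n k j
| EnvPar (j : 'I_k) : env_spec n k (n + j).

Lemma env_splitP (n k i : nat) : (i < n + k)%N -> env_spec n k i.
Proof.
move=> hi; case: (ltnP i n) => h; first exact: (EnvVar n k (Ordinal h)).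
have hk : (i - n < k)%N by lia.
by have := EnvPar n k (Ordinal hk); rewrite /= subnKC.
Qed.

Lemma definable_ext {L : language} {S : structure L} {C : S -> Prop} {n : nat}
    (D E : ('I_n -> S) -> Prop) :
  (forall a, D a <-> E a) -> definable C D -> definable C E.
Proof. by move=> h; rewrite (_ : D = E) //; apply/boolp.predeqP. Qed.

Lemma definable_sub {L : language} {S : structure L} (C C' : S -> Prop) {n : nat}
    (D : ('I_n -> S) -> Prop) :
  (forall x, C x -> C' x) -> definable C D -> definable C' D.
Proof. by move=> h [k [c [phi [hc [hp hD]]]]]; exists k, c, phi; split=> // i; exact: h. Qed.

Lemma definableT {L : language} {S : structure L} (C : S -> Prop) (n : nat) :
  definable C (fun _ : 'I_n -> S => True).
Proof.
have abs (i : 'I_0) : False by case: i.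
(* A closed formula, since for [n = 0] there is no free variable to equate with itself. *)
exists 0, (fun i => match abs i with end), (fex (feq (tvar 0) (tvar 0))).
split; first by case.
by split=> // a; split=> // _; exists (dflt S).
Qed.

Lemma definableC {L : language} {S : structure L} {C : S -> Prop} {n : nat}
    (D : ('I_n -> S) -> Prop) :
  definable C D -> definable C (fun a => ~ D a).
Proof.
move=> [k [c [phi [hc [hp hD]]]]]; exists k, c, (fneg phi); split=> //; split=> // a /=.
by rewrite hD.
Qed.

Lemma definableI {L : language} {S : structure L} {C : S -> Prop} {n : nat}
    (D E : ('I_n -> S) -> Prop) :
  definable C D -> definable C E -> definable C (fun a => D a /\ E a).
Proof.
move=> [k [c [phi [hc [hp hD]]]]] [k' [c' [psi [hc' [hp' hE]]]]].
(* The parameter tuples are concatenated: the parameter variables of the second formula move up by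
   [k], past those of the first. *)
pose r i := if (i < n)%N then i else (i + k)%N.
pose d (i : 'I_(k + k')) := match fintype.split i with inl j => c j | inr j => c' j end.
exists (k + k')%N, d, (fand phi (fren r psi)); split.
  by move=> i; rewrite /d; case: (fintype.split i).
have dl j : d (lshift k' j) = c j by rewrite /d (unsplitK (inl j)).
have dr j : d (rshift k j) = c' j by rewrite /d (unsplitK (inr j)).
split=> /=.
  split; first by apply: ffv_lt_le hp; lia.
  by apply: ffv_lt_fren hp' => i; rewrite /r; case: ifP; lia.
move=> a; rewrite hD hE sat_fren.
have -> : sat S (env a c) phi <-> sat S (env a d) phi.
  apply: sat_eq_in hp _ => i /env_splitP [j|j]; first by rewrite !env_lt.
  by rewrite env_ge -dl (env_ge S n _ a d (lshift k' j)).
suff -> : sat S (env a c') psi <-> sat S (fun i => env a d (r i)) psi by [].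
apply: sat_eq_in hp' _ => i /env_splitP [j|j].
  by rewrite /r ltn_ord !env_lt.
rewrite env_ge -dr /r ifF; last by apply/negP; lia.
by rewrite -(env_ge S n _ a d (rshift k j)) /= addnAC addnA.
Qed.

Lemma definableU {L : language} {S : structure L} {C : S -> Prop} {n : nat}
    (D E : ('I_n -> S) -> Prop) :
  definable C D -> definable C E -> definable C (fun a => D a \/ E a).
Proof.
move=> hD hE; apply: definable_ext (definableC _ (definableI _ _ (definableC _ hD) (definableC _ hE))).
move=> a /=; tauto.
Qed.

Lemma definable_embx {L : language} {S : structure L} {C : S -> Prop} {n : nat}
    (m : nat) (D : ('I_n -> S) -> Prop) :
  definable C D -> definable C (embx m D).
Proof.
move=> [k [c [phi [hc [hp hD]]]]].
pose r i := if (i < n)%N then i else (i + m)%N.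
exists k, c, (fren r phi); split=> //; split.
  by apply: ffv_lt_fren hp => i; rewrite /r; case: ifP; lia.
move=> a; rewrite /embx hD sat_fren.
apply: sat_eq_in hp _ => i /env_splitP [j|j].
  by rewrite env_lt /r ltn_ord; apply/esym/(env_lt S _ k a c (lshift m j)).
rewrite env_ge /r ifF; last by apply/negP; lia.
by rewrite addnAC env_ge.
Qed.

Lemma definable_emby {L : language} {S : structure L} {C : S -> Prop} (n : nat)
    {m : nat} (D : ('I_m -> S) -> Prop) :
  definable C D -> definable C (emby n D).
Proof.
move=> [k [c [phi [hc [hp hD]]]]].
exists k, c, (fren (addn n) phi); split=> //; split.
  by apply: ffv_lt_fren hp => i; lia.
move=> a; rewrite /emby hD sat_fren.
apply: sat_eq_in hp _ => i /env_splitP [j|j].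
  by rewrite env_lt; apply/esym/(env_lt S _ k a c (rshift n j)).
by rewrite env_ge addnA env_ge.
Qed.

Definition xyjoin {X : Type} {n m : nat} (x : 'I_n -> X) (y : 'I_m -> X) :
  'I_(n + m) -> X :=
  fun i => match fintype.split i with inl j => x j | inr j => y j end.

Lemma xyjoin_l {X : Type} {n m : nat} (x : 'I_n -> X) (y : 'I_m -> X) j :
  xyjoin x y (lshift m j) = x j.
Proof. by rewrite /xyjoin (unsplitK (inl j)). Qed.

Lemma xyjoin_r {X : Type} {n m : nat} (x : 'I_n -> X) (y : 'I_m -> X) j :
  xyjoin x y (rshift n j) = y j.
Proof. by rewrite /xyjoin (unsplitK (inr j)). Qed.

Lemma xpart_xyjoin {X : Type} {n m : nat} (x : 'I_n -> X) (y : 'I_m -> X) :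
  xpart (xyjoin x y) = x.
Proof. by apply: boolp.funext => j; exact: xyjoin_l. Qed.

Lemma xyjoin_parts {X : Type} {n m : nat} (a : 'I_(n + m) -> X) :
  xyjoin (xpart a) (ypart a) = a.
Proof.
apply: boolp.funext => i; rewrite -(splitK i); case: (fintype.split i) => j /=.
  by rewrite xyjoin_l.
by rewrite xyjoin_r.
Qed.

(* The renaming that moves the block of variables y in front of x, so that the
   quantifiers of [iter m fex] bind exactly y. *)
Definition yfront (n m i : nat) : nat :=
  if (i < n)%N then (m + i)%N else if (i < n + m)%N then (i - n)%N else i.

(** Agreement of [e] with [env x c] is asked only below [n + k]: in [tarski_vaught_tuple] the
    environment has values in the submodel, where [dflt S] need not lie. *)
Lemma sat_yfront {L : language} (S : structure L) (n m k : nat) (phi : formula L)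
    (x : 'I_n -> S) (c : 'I_k -> S) (e : nat -> S) :
  ffv_lt (n + m + k) phi ->
  (forall i, (i < n + k)%N -> e i = env x c i) ->
  forall y : nat -> S,
  sat S (fun i => if (i < m)%N then y i else e (i - m)%N) (fren (yfront n m) phi) <->
  sat S (env (xyjoin x (fun j : 'I_m => y j)) c) phi.
Proof.
move=> hp he y; rewrite sat_fren; apply: sat_eq_in hp _ => i /env_splitP [j|j].
  rewrite env_lt -(splitK j); case: (fintype.split j) => j' /=.
    rewrite xyjoin_l; have -> : yfront n m j' = (m + j')%N by rewrite /yfront ltn_ord.
    rewrite ltnNge leq_addr addKn he ?env_lt //; have := ltn_ord j'; lia.
  rewrite xyjoin_r; have -> : yfront n m (n + j') = j'.
    by rewrite /yfront ltnNge leq_addr ltn_add2l ltn_ord addKn.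
  by rewrite ltn_ord.
have -> : yfront n m (n + m + j) = (m + (n + j))%N.
  rewrite /yfront; by case: ifP; [lia|case: ifP; lia].
rewrite env_ge ltnNge leq_addr addKn he ?env_ge //; have := ltn_ord j; lia.
Qed.

Lemma ex_fun_nat {X : Type} (m : nat) (x0 : X) (P : ('I_m -> X) -> Prop) :
  (exists y : nat -> X, P (fun j => y j)) <-> exists y, P y.
Proof.
split=> -[y h]; first by eexists; exact: h.
exists (fun i => if (insub i : option 'I_m) is Some j then y j else x0).
rewrite (_ : (fun j => _) = y) //; apply: boolp.funext => j.
by rewrite insubT //= => ?; congr y; exact: val_inj.
Qed.

(** This makes the minimum over y of a [C]-definable simple function [C]-definable again: its
    sublevel sets are projections. *)
Lemma definable_proj {L : language} {S : structure L} {C : S -> Prop} {n m : nat}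
    (B : ('I_(n + m) -> S) -> Prop) :
  definable C B -> definable C (fun x : 'I_n -> S => exists y, B (xyjoin x y)).
Proof.
move=> [k [c [phi [hc [hp hB]]]]].
exists k, c, (iter m fex (fren (yfront n m) phi)); split=> //; split.
  apply: ffv_lt_iter_fex; apply: ffv_lt_fren hp => i; rewrite /yfront.
  by case: ifP; [lia|case: ifP; lia].
move=> x; rewrite sat_iter_fex -(ex_fun_nat m (dflt S) (fun y => B (xyjoin x y))).
have H y := sat_yfront S n m k phi x c _ hp (fun _ _ => erefl) y.
by split=> -[y h]; exists y; [apply/H/hB|apply/hB/H].
Qed.

Lemma tarski_vaught_tuple {L : language} {U : structure L} {M : U -> Prop}
    {n m : nat} (hM : elem_sub M) (B : ('I_(n + m) -> U) -> Prop) (x : 'I_n -> U) :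
  definable M B -> (forall i, M (x i)) -> (exists y, B (xyjoin x y)) ->
  exists2 y, (forall j, M (y j)) & B (xyjoin x y).
Proof.
move=> [k [c [phi [hc [hp hB]]]]] hx.
rewrite -(ex_fun_nat m (dflt U) (fun y => B (xyjoin x y))) => -[y hy].
have [m0 [h0 [hcl hel]]] := hM.
(* A copy of [env x c] with values in [M]; beyond [n + k] it is filled with [m0]. *)
have ex i : exists u : {x : U | M x}, (i < n + k)%N -> proj1_sig u = env x c i.
  case: (ltnP i (n + k)) => [/env_splitP [j|j]|hi].
  - by exists (exist _ _ (hx j)); rewrite env_lt.
  - by exists (exist _ _ (hc j)); rewrite env_ge.
  - by exists (exist _ _ h0).
have [e he] := boolp.choice ex.
have /hel : sat U (fun i => proj1_sig (e i)) (iter m fex (fren (yfront n m) phi)).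
  by apply/sat_iter_fex; exists y; apply/(sat_yfront U n m k phi x c _ hp he)/hB.
move=> /sat_iter_fex [z hz]; exists (fun j : 'I_m => proj1_sig (z j)).
  by move=> j; exact: proj2_sig.
apply/hB/(sat_yfront U n m k phi x c _ hp he (fun i => proj1_sig (z i))).
move/hel: hz; rewrite (_ : (fun i => proj1_sig (if _ then _ else _)) =
  (fun i => if (i < m)%N then proj1_sig (z i) else proj1_sig (e (i - m)%N))) //.
by apply: boolp.funext => i; case: ifP.
Qed.

(** * Positivity of simple functions *)

Definition indic (P : Prop) : R := if excluded_middle_informative P then 1%R else 0%R.

Lemma indicT (P : Prop) : P -> indic P = 1%R.
Proof. by rewrite /indic; case: excluded_middle_informative. Qed.

Lemma indicF (P : Prop) : ~ P -> indic P = 0%R.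
Proof. by rewrite /indic; case: excluded_middle_informative. Qed.

Lemma indic_bounds (P : Prop) : (0 <= indic P <= 1)%R.
Proof. by rewrite /indic; case: excluded_middle_informative => ? /=; lra. Qed.

Definition lsum {X : Type} (l : seq (R * (X -> Prop))) (x : X) : R :=
  foldr (fun p s => p.1 * indic (p.2 x) + s)%R 0%R l.

(** The integral over [Q] of the simple function [lsum l], computed from the presentation [l];
    nothing presupposes that it depends on the function alone. *)
Definition lint {X : Type} (mu : (X -> Prop) -> R) (Q : X -> Prop)
    (l : seq (R * (X -> Prop))) : R :=
  foldr (fun p s => p.1 * mu (fun x => p.2 x /\ Q x) + s)%R 0%R l.

Lemma kmeasure0 {L : language} {U : structure L} {C : U -> Prop} {n : nat}
    (mu : (('I_n -> U) -> Prop) -> R) (D : ('I_n -> U) -> Prop) :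
  is_kmeasure C mu -> (forall a, ~ D a) -> mu D = 0%R.
Proof.
move=> [_ [_ hadd]] hD.
have -> : D = (fun a => ~ True) by apply/boolp.predeqP => a; have := hD a; tauto.
(* The empty set is disjoint from itself, so its measure equals its own double. *)
have h := definableC _ (definableT C n).
have := hadd _ _ h h ltac:(tauto).
rewrite (_ : (fun a => ~ True \/ ~ True) = (fun a => ~ True)); first lra.
by apply/boolp.predeqP => a; tauto.
Qed.

Lemma kmeasure_split {L : language} {U : structure L} {C : U -> Prop} {n : nat}
    (mu : (('I_n -> U) -> Prop) -> R) (D E : ('I_n -> U) -> Prop) :
  is_kmeasure C mu -> definable C D -> definable C E ->
  mu D = (mu (fun a => E a /\ D a) + mu (fun a => ~ E a /\ D a))%R.
Proof.
move=> [_ [_ hadd]] hD hE; rewrite -hadd.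
- by congr mu; apply/boolp.predeqP => a; tauto.
- exact: definableI.
- by apply: definableI => //; exact: definableC.
- by move=> a; tauto.
Qed.

Lemma lint_split {L : language} {U : structure L} {C : U -> Prop} {n : nat}
    (mu : (('I_n -> U) -> Prop) -> R) (Q D : ('I_n -> U) -> Prop) l :
  is_kmeasure C mu -> List.Forall (fun p => definable C p.2) l ->
  definable C Q -> definable C D ->
  lint mu Q l = (lint mu (fun a => D a /\ Q a) l + lint mu (fun a => ~ D a /\ Q a) l)%R.
Proof.
move=> hmu + hQ hD; elim: l => [|[b E] l IH] /=; first by move=> _; lra.
move=> /List.Forall_cons_iff [/= hE /IH ->].
rewrite (kmeasure_split mu _ _ hmu (definableI _ _ hE hQ) hD).
have -> : (fun a => D a /\ E a /\ Q a) = (fun a => E a /\ D a /\ Q a).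
  by apply/boolp.predeqP => a; tauto.
have -> : (fun a => ~ D a /\ E a /\ Q a) = (fun a => E a /\ ~ D a /\ Q a).
  by apply/boolp.predeqP => a; tauto.
lra.
Qed.

(** Induction on [l]: cutting [Q] along the first set turns its term into a constant, absorbed in
    [c]. In the end either [c] is nonnegative or [Q] misses [X] and is null. In [amalgam_pos], [X]
    is everything for [lam] and the tuples from [M] for [mu]. *)
Lemma kmeasure_pos_on {L : language} {U : structure L} {C : U -> Prop} {n : nat}
    (mu : (('I_n -> U) -> Prop) -> R) (X : ('I_n -> U) -> Prop) l :
  is_kmeasure C mu ->
  (forall D, definable C D -> (forall a, X a -> ~ D a) -> mu D = 0%R) ->
  List.Forall (fun p => definable C p.2) l ->
  forall c Q, definable C Q ->
  (forall a, X a -> Q a -> 0 <= c + lsum l a)%R -> (0 <= c * mu Q + lint mu Q l)%R.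
Proof.
move=> hmu hX; have [_ [hpos _]] := hmu.
elim: l => [|[b E] l IH].
  move=> _ c Q hQ h /=; case: (Rle_dec 0 c) => hc.
    have := Rmult_le_pos _ _ hc (hpos _ hQ); lra.
  rewrite (hX _ hQ); first lra.
  by move=> a Xa Qa; have /= := h a Xa Qa; lra.
move=> /List.Forall_cons_iff [/= hE hl] c Q hQ h.
have hQ1 := definableI _ _ hE hQ.
have hQ2 := definableI _ _ (definableC _ hE) hQ.
rewrite (lint_split mu _ _ _ hmu hl hQ hE) (kmeasure_split mu Q E hmu hQ hE).
have := IH hl (c + b)%R _ hQ1.
have := IH hl c _ hQ2.
move=> h2 h1.
have {}h1 : (0 <= (c + b) * mu (fun a => E a /\ Q a) + lint mu (fun a => E a /\ Q a) l)%R.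
  by apply: h1 => a Xa [Ea Qa]; have := h a Xa Qa; rewrite indicT //; lra.
have {}h2 : (0 <= c * mu (fun a => ~ E a /\ Q a) + lint mu (fun a => ~ E a /\ Q a) l)%R.
  by apply: h2 => a Xa [Ea Qa]; have := h a Xa Qa; rewrite indicF //; lra.
lra.
Qed.

(** All subset sums of the coefficients: a finite superset of the range of [lsum l], found without
    deciding which intersections of the sets are empty. *)
Fixpoint lvals {X : Type} (l : seq (R * (X -> Prop))) : seq R :=
  if l is p :: l' then lvals l' ++ [seq (p.1 + v)%R | v <- lvals l'] else [:: 0%R].

Lemma lsum_in_lvals {X : Type} (l : seq (R * (X -> Prop))) (x : X) :
  List.In (lsum l x) (lvals l).
Proof.
elim: l => [|[b E] l IH] /=; first by left.
apply/List.in_app_iff; case: (classic (E x)) => hE.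
  rewrite indicT // Rmult_1_r; right.
  exact: (List.in_map (fun v => (b + v)%R)).
by rewrite indicF // Rmult_0_r Rplus_0_l; left.
Qed.

Lemma definable_sublevel {L : language} {U : structure L} {C : U -> Prop} {n : nat}
    (l : seq (R * (('I_n -> U) -> Prop))) (v : R) :
  List.Forall (fun p => definable C p.2) l ->
  definable C (fun a => lsum l a <= v)%R.
Proof.
elim: l v => [|[b E] l IH] v.
  move=> _; case: (Rle_dec 0 v) => h.
    by apply: definable_ext (definableT C n) => a; split=> // _.
  apply: definable_ext (definableC _ (definableT C n)) => a /=.
  by split=> // h'; case: h.
move=> /List.Forall_cons_iff [/= hE hl].
apply: definable_ext (definableU _ _ (definableI _ _ hE (IH (v - b)%R hl))
  (definableI _ _ (definableC _ hE) (IH v hl))) => a /=.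
case: (classic (E a)) => Ea; [rewrite indicT //|rewrite indicF //]; split.
- by move=> [[_]|[]] //; lra.
- by move=> h; left; split=> //; lra.
- by move=> [[]|[_]] //; lra.
- by move=> h; right; split=> //; lra.
Qed.

(** Stands in for the atoms of the finite algebra generated by [Ds]: a property that glues along
    definable cuts need only be checked on sets that no member of [Ds] cuts. *)
Lemma decided_ind {L : language} {U : structure L} {C : U -> Prop} {n : nat}
    (P : (('I_n -> U) -> Prop) -> Prop) (Ds : seq (('I_n -> U) -> Prop)) :
  List.Forall (fun D => definable C D) Ds ->
  (forall Q D, definable C Q -> definable C D ->
     P (fun a => D a /\ Q a) -> P (fun a => ~ D a /\ Q a) -> P Q) ->
  (forall Q, definable C Q ->
     List.Forall (fun D => (forall a, Q a -> D a) \/ (forall a, Q a -> ~ D a)) Ds -> P Q) ->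
  forall Q, definable C Q -> P Q.
Proof.
move=> + hsplit; elim: Ds => [|D Ds IH]; first by move=> _ h Q hQ; apply: h.
move=> /List.Forall_cons_iff [hD hDs] h; apply: IH => // Q hQ dec.
apply: (hsplit Q D) => //; apply: h.
- exact: definableI.
- constructor; first by left=> a [].
  by apply: List.Forall_impl dec => E [] H; [left|right] => a [_ /H].
- by apply: definableI => //; exact: definableC.
- constructor; first by right=> a [].
  by apply: List.Forall_impl dec => E [] H; [left|right] => a [_ /H].
Qed.

Lemma list_min (T : R -> Prop) (V : seq R) :
  (exists2 v, List.In v V & T v) ->
  exists v, [/\ List.In v V, T v & forall w, List.In w V -> T w -> (v <= w)%R].
Proof.
elim: V => [[v []]|v V IH].
case: (classic (exists2 v, List.In v V & T v)) => [/IH [w [hw Tw wmin]] _|no].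
  case: (classic (T v /\ v <= w)%R) => [[Tv vw]|nv].
    exists v; split=> //; first by left.
    by move=> u [->|hu] Tu; [lra|have := wmin _ hu Tu; lra].
  exists w; split=> //; first by right.
  move=> u [<-|hu] Tu; last exact: wmin.
  by case: (Rle_dec v w) => h; [case: nv|lra].
move=> [w [<-|hw] Tw]; last by case: no; exists w.
exists v; split=> //; first by left.
by move=> u [->|hu] Tu; [lra|case: no; exists u].
Qed.

Lemma fin_sat_null {L : language} {U : structure L} {n : nat}
    (mu : (('I_n -> U) -> Prop) -> R) (M : U -> Prop) (D : ('I_n -> U) -> Prop) :
  is_kmeasure (allS U) mu -> fin_sat_in mu M -> definable (allS U) D ->
  (forall a, (forall i, M (a i)) -> ~ D a) -> mu D = 0%R.
Proof.
move=> [_ [hpos _]] hfs hD h; have := hpos _ hD => h0.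
case: (Rlt_dec 0 (mu D)) => [/(hfs _ hD) [a [/h]]|] //; lra.
Qed.

(* On a set Q deciding the projections of all sublevel sets of f, the function
   min_y f is a constant c, so the two integrals decouple:
   [f >= c] bounds the one against lam and [c + g >= 0] the one against mu. *)
Lemma amalgam_pos {L : language} {U : structure L} {A M : U -> Prop} {n m : nat}
    (mu : (('I_n -> U) -> Prop) -> R) (lam : (('I_(n + m) -> U) -> Prop) -> R)
    (f : seq (R * (('I_(n + m) -> U) -> Prop))) (g : seq (R * (('I_n -> U) -> Prop))) :
  elem_sub M -> (forall x, A x -> M x) ->
  is_kmeasure (allS U) mu -> fin_sat_in mu M ->
  is_kmeasure A lam -> (forall D, definable A D -> lam (embx m D) = mu D) ->
  List.Forall (fun p => definable A p.2) f ->
  List.Forall (fun p => definable (allS U) p.2) g ->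
  (forall a, (forall i, M (a i)) -> 0 <= lsum f a + lsum g (xpart a))%R ->
  (0 <= lint lam (fun _ => True) f + lint mu (fun _ => True) g)%R.
Proof.
move=> hM hAM hmu hfs hlam hx hf hg hfg.
have toU n' (D : ('I_n' -> U) -> Prop) : definable A D -> definable (allS U) D.
  exact: definable_sub.
pose Dv v := fun x : 'I_n -> U => exists y : 'I_m -> U, (lsum f (xyjoin x y) <= v)%R.
have hDv v : definable A (Dv v).
  exact: (definable_proj (fun a => lsum f a <= v)%R (definable_sublevel f v hf)).
pose P Q := (0 <= lint lam (embx m Q) f + lint mu Q g)%R.
(* All cuts are along [A]-definable sets, so on each piece [lam] and [mu] can still be compared
   through [hx]. *)
apply: (@decided_ind L U A n P [seq Dv v | v <- lvals f]).
- by apply/List.Forall_forall => D /List.in_map_iff [v [<- _]].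
- move=> Q D hQ hD; rewrite /P.
  rewrite (lint_split lam (embx m Q) (embx m D) f hlam hf
    (definable_embx m _ hQ) (definable_embx m _ hD)).
  by rewrite (lint_split mu Q D g hmu hg (toU _ _ hQ) (toU _ _ hD)) /embx; lra.
- move=> Q hQ /List.Forall_forall dec.
  have hQx := definable_embx m _ hQ.
  have lam0 D : definable A D -> (forall a, True -> ~ D a) -> lam D = 0%R.
    by move=> _ h; apply: (kmeasure0 lam D hlam) => a; exact: h.
  have mu0 D := fin_sat_null mu M D hmu hfs.
  case: (classic (exists x, Q x)) => [[x0 Qx0]|nQ]; last first.
    have h1 := kmeasure_pos_on lam _ f hlam lam0 hf 0 _ hQx.
    have h2 := kmeasure_pos_on mu _ g hmu mu0 hg 0 _ (toU _ _ hQ).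
    have {}h1 := h1 ltac:(by move=> a _ Qa; case: nQ; exists (xpart a)).
    have {}h2 := h2 ltac:(by move=> a _ Qa; case: nQ; exists a).
    rewrite /P; lra.
  (* [c] is the least candidate value whose sublevel projection covers [Q]. One such value exists:
     the value of [f] at a point over [x0], because [Q] decides its projection and [x0] lies in
     it. *)
  have [|c [cV cQ cmin]] := list_min (fun v => forall x, Q x -> Dv v x) (lvals f).
    pose v := lsum f (xyjoin x0 (fun _ => dflt U)); exists v; first exact: lsum_in_lvals.
    have [|//|no] := dec (Dv v); first exact/List.in_map/lsum_in_lvals.
    by case: (no _ Qx0); exists (fun _ => dflt U); rewrite /v; lra.
  (* If [f] took a value below [c] over [Q], the projection of that sublevel set would meet [Q],
     hence cover it, against the minimality of [c]. *)
  have h1 : (0 <= - c * lam (embx m Q) + lint lam (embx m Q) f)%R.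
    apply: (kmeasure_pos_on lam _ f hlam lam0 hf) => // a _ Qa.
    have aD : Dv (lsum f a) (xpart a) by exists (ypart a); rewrite xyjoin_parts; lra.
    have := cmin _ (lsum_in_lvals f a).
    have [||no] := dec (Dv (lsum f a)); first exact/List.in_map/lsum_in_lvals.
      by move=> + h => /h; lra.
    by case: (no _ Qa).
  have h2 : (0 <= c * mu Q + lint mu Q g)%R.
    apply: (kmeasure_pos_on mu _ g hmu mu0 hg) => [|x Mx Qx]; first exact: toU.
    have hB := definable_sub A M _ hAM (definable_sublevel f c hf).
    (* The point where [f] is at most [c] is found with y in [M], so the hypothesis on tuples from
       [M] applies to it. *)
    have [y My hy] := tarski_vaught_tuple hM _ x hB Mx (cQ _ Qx).
    have := hfg (xyjoin x y); rewrite xpart_xyjoin => h.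
    have {}h := h ltac:(by move=> i; rewrite /xyjoin; case: fintype.split).
    lra.
  rewrite hx // in h1; rewrite /P; lra.
- exact: definableT.
Qed.

(** * Amalgamation of measures *)

(* A partial assignment of values to sets is a graph G; lists of
   (coefficient, (set, value)) stand for linear combinations. *)
Definition gsum {X : Type} (l : seq (R * ((X -> Prop) * R))) (x : X) : R :=
  foldr (fun p s => p.1 * indic (p.2.1 x) + s)%R 0%R l.

Definition gval {X : Type} (l : seq (R * ((X -> Prop) * R))) : R :=
  foldr (fun p s => p.1 * p.2.2 + s)%R 0%R l.

Definition gscale {X : Type} (k : R) (l : seq (R * ((X -> Prop) * R))) :=
  [seq ((k * p.1)%R, p.2) | p <- l].

Definition supported {X : Type} (G : (X -> Prop) * R -> Prop)
    (l : seq (R * ((X -> Prop) * R))) : Prop := List.Forall (fun p => G p.2) l.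

(** Coherence of a relation rather than of a function: it excludes by itself two prices for one set,
    as [coherent_additive] shows. *)
Definition coherent {X : Type} (S : X -> Prop) (G : (X -> Prop) * R -> Prop) : Prop :=
  forall l, supported G l -> (forall x, S x -> 0 <= gsum l x)%R -> (0 <= gval l)%R.

Lemma gsum_cat {X : Type} (l l' : seq (R * ((X -> Prop) * R))) x :
  gsum (l ++ l') x = (gsum l x + gsum l' x)%R.
Proof. by elim: l => [|p l IH] /=; [lra|rewrite IH; lra]. Qed.

Lemma gval_cat {X : Type} (l l' : seq (R * ((X -> Prop) * R))) :
  gval (l ++ l') = (gval l + gval l')%R.
Proof. by elim: l => [|p l IH] /=; [lra|rewrite IH; lra]. Qed.

Lemma gsum_scale {X : Type} k (l : seq (R * ((X -> Prop) * R))) x :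
  gsum (gscale k l) x = (k * gsum l x)%R.
Proof. by elim: l => [|p l IH] /=; [lra|rewrite IH; lra]. Qed.

Lemma gval_scale {X : Type} k (l : seq (R * ((X -> Prop) * R))) :
  gval (gscale k l) = (k * gval l)%R.
Proof. by elim: l => [|p l IH] /=; [lra|rewrite IH; lra]. Qed.

Lemma supported_scale {X : Type} (G : (X -> Prop) * R -> Prop) k l :
  supported G l -> supported G (gscale k l).
Proof. by elim: l => [|p l IH] //= /List.Forall_cons_iff [h /IH hl]; constructor. Qed.

Lemma supported_cat {X : Type} (G : (X -> Prop) * R -> Prop) l l' :
  supported G l -> supported G l' -> supported G (l ++ l').
Proof. by move=> h h'; apply/List.Forall_app. Qed.

(** Gathers all bets on the new pair into one coefficient [a], on whose sign [coherent_extend]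
    argues. *)
Lemma supported_collect {X : Type} (G : (X -> Prop) * R -> Prop) E r l :
  supported (fun p => G p \/ p = (E, r)) l ->
  exists a l', [/\ supported G l', gval l = (a * r + gval l')%R &
    forall x, gsum l x = (a * indic (E x) + gsum l' x)%R].
Proof.
elim: l => [|[b q] l IH] /=.
  by move=> _; exists 0%R, [::]; split=> [||x] /=; [constructor|lra|lra].
move=> /List.Forall_cons_iff [/= hq /IH [a [l' [hl hv hs]]]].
case: hq => [Gq|->]; last first.
  exists (b + a)%R, l'; split=> // [|x]; rewrite ?hv ?hs /=; lra.
exists a, ((b, q) :: l'); split=> [||x] /=; rewrite ?hv ?hs; [by constructor|lra|lra].
Qed.

(* de Finetti's fundamental theorem: the admissible values for E form the
   interval between the inner and the outer price of E; take the inner one. *)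
Lemma coherent_extend {X : Type} (S : X -> Prop) (G : (X -> Prop) * R -> Prop)
    (E : X -> Prop) :
  coherent S G -> G (fun _ => True, 1%R) ->
  exists r, coherent S (fun p => G p \/ p = (E, r)).
Proof.
move=> coh G1.
pose low s := exists l, [/\ supported G l, s = gval l &
  forall x, S x -> (gsum l x <= indic (E x))%R].
(* Every inner price lies below every outer price, by coherence of the difference. *)
have sub_low u s : supported G u -> (forall x, S x -> (indic (E x) <= gsum u x)%R) ->
    low s -> (s <= gval u)%R.
  move=> hu uE [l [hl -> lE]].
  have := coh (u ++ gscale (-1) l) (supported_cat _ _ _ hu (supported_scale _ _ _ hl)).
  rewrite gval_cat gval_scale => h; suff : (0 <= gval u + -1 * gval l)%R by lra.
  apply: h => x Sx; rewrite gsum_cat gsum_scale.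
  by have := uE x Sx; have := lE x Sx; lra.
have [|| r [r_ub r_lub]] := completeness low.
- exists 1%R => s hs.
  suff : (s <= gval [:: (1%R, ((fun _ => True) : X -> Prop, 1%R))])%R by move=> /=; lra.
  apply: sub_low hs; first by constructor; [exact: G1|constructor].
  by move=> x _ /=; rewrite (indicT True) //; have := indic_bounds (E x); lra.
- exists 0%R, [::]; split; [exact: List.Forall_nil|by []|].
  by move=> x _ /=; have := indic_bounds (E x); lra.
exists r => l /supported_collect [a [l' [hl' -> hs]]] hpos.
have {}hpos x : S x -> (0 <= a * indic (E x) + gsum l' x)%R by rewrite -hs; apply: hpos.
case: (Rtotal_order a 0) => [a0|[a0|a0]].
(* For negative [a], this multiple of [l'] dominates [E] on [S], so its value is an outer price and
   bounds [r] from above. *)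
- pose u := gscale (/ - a) l'.
  have ia : (0 < / - a)%R by apply: Rinv_0_lt_compat; lra.
  have iaa : (/ - a * a = -1)%R by field; lra.
  suff : (r <= gval u)%R.
    rewrite gval_scale => h.
    have := Rmult_le_compat_l (- a) _ _ ltac:(lra) h.
    have -> : (- a * (/ - a * gval l') = gval l')%R by field; lra.
    lra.
  apply: r_lub => s; apply: sub_low; first exact: supported_scale.
  move=> x Sx; rewrite gsum_scale.
  have := Rmult_le_pos _ _ (Rlt_le _ _ ia) (hpos x Sx).
  rewrite Rmult_plus_distr_l -Rmult_assoc iaa; lra.
- have := coh l' hl'; rewrite a0 => h; suff : (0 <= gval l')%R by lra.
  by apply: h => x /hpos; rewrite a0; lra.
(* For positive [a], this multiple of [l'] lies below [E] on [S], so its value is an inner price and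
   at most [r]. *)
- pose u := gscale (- / a) l'.
  have ia : (0 < / a)%R by apply: Rinv_0_lt_compat.
  have iaa : (/ a * a = 1)%R by field; lra.
  have : (gval u <= r)%R.
    apply: r_ub; exists u; split=> //; first exact: supported_scale.
    move=> x Sx; rewrite gsum_scale.
    have := Rmult_le_pos _ _ (Rlt_le _ _ ia) (hpos x Sx).
    rewrite Rmult_plus_distr_l -Rmult_assoc iaa; lra.
  rewrite gval_scale => h.
  have := Rmult_le_compat_l a _ _ ltac:(lra) h.
  have -> : (a * (- / a * gval l') = - gval l')%R by field; lra.
  lra.
Qed.

Lemma coherent_total {X : Type} (S : X -> Prop) (G0 : (X -> Prop) * R -> Prop) :
  coherent S G0 -> G0 (fun _ => True, 1%R) ->
  exists G, [/\ coherent S G, forall p, G0 p -> G p & forall E, exists r, G (E, r)].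
Proof.
move=> coh0 G01.
(* [G0] is joined inside [P], so that the union of the empty chain qualifies too. *)
pose P (G : classical_sets.set ((X -> Prop) * R)) := coherent S (fun p => G p \/ G0 p).
have [F FP totF|G [PG Gmax]] := @classical_sets.Zorn_bigcup _ P.
  move=> l hl hpos.
  (* A finite list is supported by one member of the chain; an empty [K] serves when [G0] alone
     suffices. *)
  have [K [PK hK]] : exists K : classical_sets.set ((X -> Prop) * R),
      (F K \/ forall p, ~ K p) /\ supported (fun p => K p \/ G0 p) l.
    elim: l hl {hpos} => [|p l IH].
      by move=> _; exists (fun _ => False); split; [right=> ? []|exact: List.Forall_nil].
    move=> /List.Forall_cons_iff [hp /IH [K [FK hK]]].
    case: hp => [[K' FK' K'p]|G0p]; last by exists K; split=> //; constructor=> //; right.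
    have [le|le] : (forall q, K q -> K' q) \/ (forall q, K' q -> K q).
    - case: FK => [FK|K0]; last by left=> q /K0.
      by have [le|le] := totF _ _ FK FK'; [left|right].
    - exists K'; split; [by left|constructor; first by left].
      by apply: List.Forall_impl hK => q [/le|]; [left|right].
    - exists K; split=> //; constructor=> //; left; exact: le.
  case: PK => [/FP PK|K0]; first exact: (PK l).
  by apply: (coh0 l) => //; apply: List.Forall_impl hK => q [/K0|].
exists (fun p => G p \/ G0 p); split=> // [p|E]; first by right.
have [r hr] := coherent_extend S _ E PG (or_intror G01).
exists r; apply: NNPP => nG.
apply: (Gmax (fun p => G p \/ p = (E, r))).
  split; first by move=> p; left.
  by move=> h; apply: nG; left; apply: h; right.
by move=> l hl; apply: hr; apply: List.Forall_impl hl => q; tauto.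
Qed.

(** Each property comes from a short list of bets whose total is nonnegative on [S]; equalities come
    from totals that vanish there, used with both signs. *)
Lemma coherent_additive {X : Type} (S : X -> Prop) (G : (X -> Prop) * R -> Prop)
    (om : (X -> Prop) -> R) :
  coherent S G -> G (fun _ => True, 1%R) -> (forall E, G (E, om E)) ->
  [/\ forall E r, G (E, r) -> om E = r,
      forall E, (0 <= om E)%R,
      forall E, (forall x, S x -> ~ E x) -> om E = 0%R &
      forall D E, (forall x, ~ (D x /\ E x)) ->
        om (fun x => D x \/ E x) = (om D + om E)%R].
Proof.
move=> coh G1 Gom.
have pos1 a E r : G (E, r) -> (forall x, S x -> 0 <= a * indic (E x))%R -> (0 <= a * r)%R.
  move=> GE h; have := coh [:: (a, (E, r))]; rewrite /= !Rplus_0_r; apply.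
    by apply: List.Forall_cons => //; exact: List.Forall_nil.
  by move=> x /h; rewrite Rplus_0_r.
have pos E : (0 <= om E)%R.
  have := pos1 1%R E (om E) (Gom E); rewrite Rmult_1_l; apply=> x _.
  by have := indic_bounds (E x); lra.
split=> //.
- have le E r r' : G (E, r) -> G (E, r') -> (r <= r')%R.
    move=> h h'; have := coh [:: (1%R, (E, r')); ((-1)%R, (E, r))].
    move=> H; suff : (0 <= gval [:: (1%R, (E, r')); ((-1)%R, (E, r))])%R by move=> /=; lra.
    apply: H; first by do 2!(apply: List.Forall_cons => //); exact: List.Forall_nil.
    by move=> x _ /=; lra.
  by move=> E r h; apply: Rle_antisym; apply: (le E).
- move=> E hE; have := pos1 (-1)%R E (om E) (Gom E).
  move=> h; have := pos E.
  have : (0 <= -1 * om E)%R by apply: h => x Sx; rewrite indicF; [lra|exact: hE].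
  lra.
- move=> D E DE; pose DUE := (fun x => D x \/ E x).
  have key a : (0 <= a * om DUE + - a * om D + - a * om E)%R.
    have := coh [:: (a, (DUE, om DUE)); ((- a)%R, (D, om D)); ((- a)%R, (E, om E))].
    move=> H; suff : (0 <= gval [:: (a, (DUE, om DUE)); ((- a)%R, (D, om D)); ((- a)%R, (E, om E))])%R.
      by move=> /=; lra.
    apply: H; first by do 3!(apply: List.Forall_cons; first exact: Gom); exact: List.Forall_nil.
    move=> x _ /=; have := DE x.
    case: (classic (D x)) => Dx; case: (classic (E x)) => Ex => H.
    + by case: H.
    + by rewrite (indicT (DUE x)) ?(indicT (D x)) ?(indicF (E x)) //; [lra|left].
    + by rewrite (indicT (DUE x)) ?(indicF (D x)) ?(indicT (E x)) //; [lra|right].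
    + by rewrite (indicF (DUE x)) ?(indicF (D x)) ?(indicF (E x)) //; [lra|case].
  by rewrite -/DUE; have := key 1%R; have := key (-1)%R; lra.
Qed.

(** By [amalgam_pos] the values of [lam] and [mu] are jointly coherent on the tuples from [M]. Any
    total coherent extension gives 0 to sets without such tuples, which is finite satisfiability. *)
Lemma exists_fin_sat_amalgam {L : language} {U : structure L} {A M : U -> Prop}
    {n m : nat} (mu : (('I_n -> U) -> Prop) -> R) (lam : (('I_(n + m) -> U) -> Prop) -> R) :
  elem_sub M -> (forall x, A x -> M x) ->
  is_kmeasure (allS U) mu -> fin_sat_in mu M ->
  is_kmeasure A lam -> (forall D, definable A D -> lam (embx m D) = mu D) ->
  exists om, [/\ is_kmeasure (allS U) om, fin_sat_in om M,
    forall D, definable A D -> om D = lam D &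
    forall D, definable (allS U) D -> om (embx m D) = mu D].
Proof.
move=> hM hAM hmu hfs hlam hx.
pose T := 'I_(n + m) -> U.
pose S := fun a : T => forall i, M (a i).
pose G0 (p : (T -> Prop) * R) := (definable A p.1 /\ p.2 = lam p.1) \/
  (exists D, [/\ definable (allS U) D, p.1 = embx m D & p.2 = mu D]).
have coh0 : coherent S G0.
  move=> l hl hpos.
  (* A mixed list is sorted into its bets priced by [lam] and those priced by [mu]. *)
  have [f [g [hf hg hv hs]]] : exists f g,
      [/\ List.Forall (fun p => definable A p.2) f,
          List.Forall (fun p => definable (allS U) p.2) g,
          gval l = (lint lam (fun _ => True) f + lint mu (fun _ => True) g)%R &
          forall a, gsum l a = (lsum f a + lsum g (xpart a))%R].
    elim: l hl {hpos} => [|[a [E r]] l IH].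
      by move=> _; exists [::], [::]; split=> [|||a] /=;
        try (exact: List.Forall_nil); lra.
    move=> /List.Forall_cons_iff [hE /IH [f [g [hf hg hv hs]]]].
    have ET Y (D : Y -> Prop) : (fun x => D x /\ True) = D.
      by apply/boolp.predeqP => x; tauto.
    case: hE => [[/= dE ->]|[D [/= dD -> ->]]].
      exists ((a, E) :: f), g; split=> [|||b] /=; rewrite ?hv ?hs ?ET //.
      - exact: List.Forall_cons.
      - lra.
      - lra.
    exists f, ((a, D) :: g); split=> [|||b] /=; rewrite ?hv ?hs ?ET //.
    - exact: List.Forall_cons.
    - lra.
    - rewrite /embx; lra.
  rewrite hv; apply: (amalgam_pos mu lam f g hM hAM) => // a Ma.
  by rewrite -hs; exact: hpos.
have G01 : G0 (fun _ => True, 1%R).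
  by left; split=> /=; [exact: definableT|case: hlam].
have [G [coh sub tot]] := coherent_total S G0 coh0 G01.
have [om Gom] := boolp.choice tot.
have [val pos null add] := coherent_additive S G om coh (sub _ G01) Gom.
exists om; split.
- split; first exact/val/sub.
  by split=> [D _|D E _ _]; [exact: pos|exact: add].
- move=> D _ D0; apply: NNPP => no; have := null D; rewrite /S => h.
  suff : om D = 0%R by lra.
  by apply: h => a Ma Da; apply: no; exists a.
- by move=> D hD; apply/val/sub; left.
- by move=> D hD; apply/val/sub; right; exists D.
Qed.

(** [A] and [M] are kept apart to serve both claims: [A = M] in the first, a larger model around [A]
    in the second. *)
Lemma fin_sat_in_geE_at {L : language} {U : structure L} {A M : U -> Prop} {n m : nat}
    (mu : (('I_n -> U) -> Prop) -> R) (nu : (('I_m -> U) -> Prop) -> R) :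
  elem_sub M -> (forall x, A x -> M x) -> is_kmeasure (allS U) mu ->
  fin_sat_in mu M -> geE_at A mu nu -> fin_sat_in nu M.
Proof.
move=> hM hAM hmu hfs [lam [hlam [hx hge]]].
have [om [hom omfs omlam omx]] := exists_fin_sat_amalgam mu lam hM hAM hmu hfs hlam hx.
move=> D hD; rewrite -(hge om hom omlam omx D hD) => h.
have [a [Ma Da]] := omfs _ (definable_emby n _ hD) h.
by exists (ypart a); split=> // j; exact: Ma.
Qed.

(** * Cardinals and the Lowenheim-Skolem theorem *)

Lemma sig_inj {X : Type} {P : X -> Prop} (u v : {x | P x}) :
  proj1_sig u = proj1_sig v -> u = v.
Proof.
case: u v => [x hx] [y hy] /= e; case: y / e hy => hy.
by congr exist; exact: proof_irrelevance.
Qed.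

Lemma card_le_refl (X : Type) : card_le X X.
Proof. by exists (fun x => x). Qed.

Lemma card_le_trans (X Y Z : Type) : card_le X Y -> card_le Y Z -> card_le X Z.
Proof. by move=> [f hf] [g hg]; exists (g \o f); exact: inj_comp. Qed.

Lemma card_le_lt_trans (X Y Z : Type) : card_le X Y -> card_lt Y Z -> card_lt X Z.
Proof.
move=> h [h1 h2]; split; first exact: card_le_trans h h1.
by move=> h3; apply: h2; exact: card_le_trans h3 h.
Qed.

Lemma card_le_sum (X X' Y Y' : Type) :
  card_le X X' -> card_le Y Y' -> card_le (X + Y) (X' + Y').
Proof.
move=> [f hf] [g hg].
exists (fun z => match z with inl x => inl (f x) | inr y => inr (g y) end).
by move=> [x|y] [x'|y'] // [] => [/hf|/hg] ->.
Qed.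

Lemma card_le_prod (X X' Y Y' : Type) :
  card_le X X' -> card_le Y Y' -> card_le (X * Y) (X' * Y').
Proof.
move=> [f hf] [g hg]; exists (fun z => (f z.1, g z.2)).
by move=> [x y] [x' y'] /= [/hf -> /hg ->].
Qed.

Lemma card_le_map_seq (X Y : Type) : card_le X Y -> card_le (seq X) (seq Y).
Proof. by move=> [f hf]; exists (map f); exact: inj_map. Qed.

Lemma card_le_graph (X Y : Type) (G : X -> Y -> Prop) :
  (forall x, exists y, G x y) -> (forall x x' y, G x y -> G x' y -> x = x') -> card_le X Y.
Proof.
move=> tot inj; have [f hf] := boolp.choice tot; exists f => x x' e.
by apply: (inj x x' (f x)) => //; rewrite e.
Qed.

(** A maximal graph of a partial injection is total on one side; otherwise a pair of missed points
    could be added. *)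
Lemma card_le_total (X Y : Type) : card_le X Y \/ card_le Y X.
Proof.
pose P (G : classical_sets.set (X * Y)) :=
  forall p q, G p -> G q -> (p.1 = q.1 <-> p.2 = q.2).
have [F FP totF|G [PG Gmax]] := @classical_sets.Zorn_bigcup _ P.
  move=> p q [K FK Kp] [K' FK' K'q].
  by have [le|le] := totF _ _ FK FK'; [apply: (FP _ FK')|apply: (FP _ FK)] => //; exact: le.
case: (classic (forall x, exists y, G (x, y))) => [tot|nx].
  by left; apply: (card_le_graph X Y (fun x y => G (x, y))) => // x x' y h /(PG _ _ h) [_]; exact.
case: (classic (forall y, exists x, G (x, y))) => [tot|ny].
  by right; apply: (card_le_graph Y X (fun y x => G (x, y))) => // y y' x h /(PG _ _ h) [+ _]; exact.
have [x0 hx0] := not_all_ex_not _ _ nx.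
have [y0 hy0] := not_all_ex_not _ _ ny.
exfalso; apply: (Gmax (fun p => G p \/ p = (x0, y0))).
  split; first by move=> p; left.
  by move=> h; apply: hx0; exists y0; apply: h; right.
move=> [x y] [x' y'] [h|[-> ->]] [h'|[-> ->]] //=; first exact: PG h h'.
- split=> e; [case: hx0; exists y|case: hy0; exists x]; by rewrite -e.
- split=> e; [case: hx0; exists y'|case: hy0; exists x']; by rewrite e.
Qed.

Lemma flatten_map2_inj (X Y : Type) (D : X -> Prop) (a b : X -> Y) (s s' : seq X) :
  (forall x x', D x -> D x' -> a x = a x' -> b x = b x' -> x = x') ->
  List.Forall D s -> List.Forall D s' ->
  flatten [seq [:: a x; b x] | x <- s] = flatten [seq [:: a x; b x] | x <- s'] -> s = s'.
Proof.
move=> inj; elim: s s' => [|x s IH] [|x' s'] //=.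
move=> /List.Forall_cons_iff [Dx Ds] /List.Forall_cons_iff [Dx' Ds'] [ea eb /(IH _ Ds Ds') ->].
by rewrite (inj x x').
Qed.

Lemma Forall_flatten_map2 (X Y : Type) (D : X -> Prop) (A : Y -> Prop) (a b : X -> Y)
    (s : seq X) :
  (forall x, D x -> A (a x) /\ A (b x)) -> List.Forall D s ->
  List.Forall A (flatten [seq [:: a x; b x] | x <- s]).
Proof.
move=> h; elim: s => [|x s IH] /=; first by move=> _; exact: List.Forall_nil.
move=> /List.Forall_cons_iff [/h [? ?] /IH ?].
by do 2!apply: List.Forall_cons => //.
Qed.

(** * Finite sequences over an infinite set *)

Definition sdom {X : Type} (G : seq X * X -> Prop) (x : X) : Prop :=
  exists y, G ([:: x], y).

(** The graph of an injection of the nonempty words over a set into that set, the set being read off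
    the one-letter words. Excluding the empty word lets the empty graph qualify, as the empty chain
    in Zorn's lemma demands. *)
Definition seq_inj {X : Type} (G : seq X * X -> Prop) : Prop :=
  [/\ forall p q, G p -> G q -> (p.1 = q.1 <-> p.2 = q.2),
      forall s, (exists y, G (s, y)) <-> s <> [::] /\ List.Forall (sdom G) s &
      forall s y, G (s, y) -> sdom G y].

(* Two-letter blocks [:: tag; x] code the elements of a union of two copies of
   the domain, the tag telling the copies apart. *)
Lemma seq_inj_code {X : Type} (G : seq X * X -> Prop) (x0 : X) (D : X -> Prop)
    (k : X -> X) :
  seq_inj G -> sdom G x0 ->
  (forall x, D x -> ~ sdom G x -> sdom G (k x)) ->
  (forall x x', D x -> D x' -> ~ sdom G x -> ~ sdom G x' -> k x = k x' -> x = x') ->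
  exists code : seq X -> X,
    (forall s, List.Forall D s -> sdom G (code s)) /\
    (forall s s', List.Forall D s -> List.Forall D s' -> code s = code s' -> s = s').
Proof.
move=> [inj dom val] A0 kA kinj; set A := sdom G in A0 kA kinj *.
have ex s : exists y, s <> [::] -> List.Forall A s -> G (s, y).
  case: (classic (exists y, G (s, y))) => [[y h]|no]; first by exists y.
  by exists x0 => s0 As; case: no; apply/dom.
have [phi hphi] := boolp.choice ex.
have phiA s : s <> [::] -> List.Forall A s -> A (phi s) by move=> s0 /(hphi _ s0) /val.
have phi_inj s s' : s <> [::] -> s' <> [::] -> List.Forall A s -> List.Forall A s' ->
    phi s = phi s' -> s = s'.
  by move=> s0 s0' As As' e; have [_ /= h] := inj _ _ (hphi _ s0 As) (hphi _ s0' As'); exact: h.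
have A00 : List.Forall A [:: x0] by apply: List.Forall_cons => //; exact: List.Forall_nil.
have A000 : List.Forall A [:: x0; x0] by apply: List.Forall_cons.
(* Two distinct tags: images of words of different length. *)
pose x1 := phi [:: x0]; pose x2 := phi [:: x0; x0].
have Ax1 : A x1 by apply: phiA.
have Ax2 : A x2 by apply: phiA.
have x12 : x1 <> x2 by move=> /phi_inj e; have := e ltac:(by []) ltac:(by []) A00 A000.
pose tag x := if excluded_middle_informative (A x) then x1 else x2.
pose cont x := if excluded_middle_informative (A x) then x else k x.
(* The leading letter keeps the word nonempty when [s] is empty. *)
pose blocks s := x1 :: flatten [seq [:: tag x; cont x] | x <- s].
have Ablocks s : List.Forall D s -> List.Forall A (blocks s).
  move=> Ds; apply: List.Forall_cons => //; apply: Forall_flatten_map2 Ds => x Dx.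
  by rewrite /tag /cont; case: excluded_middle_informative => Ax /=; split=> //; exact: kA.
exists (fun s => phi (blocks s)); split=> [s Ds|s s' Ds Ds'].
  by apply: phiA => //; exact: Ablocks.
move=> /phi_inj e; have {e} := e ltac:(by []) ltac:(by []) (Ablocks _ Ds) (Ablocks _ Ds').
move=> [] /flatten_map2_inj; apply; [|exact: Ds|exact: Ds'] => x x' Dx Dx'.
rewrite /tag /cont; case: excluded_middle_informative => Ax; case: excluded_middle_informative => Ax' //=.
- by move=> /esym.
- by move=> _; exact: kinj.
Qed.

(** The domain is enlarged by its disjoint copy under [g]. A word with a letter in the copy is coded
    into the old domain and then sent by [g] into the copy, where no old value lies. *)
Lemma seq_inj_extend {X : Type} (G : seq X * X -> Prop) (x0 : X) (g : X -> X) :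
  seq_inj G -> sdom G x0 ->
  (forall x, sdom G x -> ~ sdom G (g x)) ->
  (forall x x', sdom G x -> sdom G x' -> g x = g x' -> x = x') ->
  exists G', [/\ seq_inj G', forall p, G p -> G' p & exists p, G' p /\ ~ G p].
Proof.
move=> hG A0 gA ginj; have [inj dom val] := hG.
pose B x := exists a, sdom G a /\ g a = x.
pose D x := sdom G x \/ B x.
have ex x : exists y, B x -> sdom G y /\ g y = x.
  by case: (classic (B x)) => [[y hy]|no]; [exists y|exists x0].
have [k hk] := boolp.choice ex.
have [code [codeA code_inj]] : exists code : seq X -> X,
    (forall s, List.Forall D s -> sdom G (code s)) /\
    (forall s s', List.Forall D s -> List.Forall D s' -> code s = code s' -> s = s').
  apply: (seq_inj_code G x0 D k) => // [x [//|/hk []]//|x x' [//|/hk [_ e]]].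
  by move=> [//|/hk [_ e']] _ _ ee; rewrite -e -e' ee.
pose New (p : seq X * X) := [/\ p.1 <> [::], List.Forall D p.1,
  ~ List.Forall (sdom G) p.1 & p.2 = g (code p.1)].
pose G' p := G p \/ New p.
have nA p : New p -> ~ sdom G p.2.
  by move=> [_ Dp _ ->]; apply: gA; exact: codeA.
have sub x : sdom G x -> sdom G' x by move=> [y h]; exists y; left.
have one (Q : X -> Prop) x : Q x -> List.Forall Q [:: x].
  by move=> h; apply: List.Forall_cons => //; exact: List.Forall_nil.
have domG' x : sdom G' x <-> D x.
  split=> [[y [h|[_ /= h _ _]]]|h]; first by left; exists y.
    by case/List.Forall_cons_iff: h.
  case: (classic (sdom G x)) => Ax; first exact: sub.
  exists (g (code [:: x])); right; split=> //=; first exact: one.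
  by case/List.Forall_cons_iff.
exists G'; split.
- split.
  + move=> p q [Gp|Np] [Gq|Nq].
    * exact: inj.
    * have Ap : List.Forall (sdom G) p.1.
        by apply: (proj1 (dom p.1) _).2; exists p.2; case: p Gp.
      split=> e; first by case: Nq => _ _ [] ; rewrite -e.
      by case: (nA _ Nq); rewrite -e; apply: (val p.1); case: p Gp {Ap e}.
    * have Aq : List.Forall (sdom G) q.1.
        by apply: (proj1 (dom q.1) _).2; exists q.2; case: q Gq.
      split=> e; first by case: Np => _ _ [] ; rewrite e.
      by case: (nA _ Np); rewrite e; apply: (val q.1); case: q Gq {Aq e}.
    * case: Np Nq => _ Dp _ -> [_ Dq _ ->]; split=> [-> //|e].
      by apply: code_inj => //; apply: ginj => //; exact: codeA.
  + move=> s; have FD : List.Forall (sdom G') s <-> List.Forall D s.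
      by split; apply: List.Forall_impl => x /domG'.
    split=> [[y [h|[/= s0 Ds _ _]]]|[s0 /FD Ds]].
    * have [s0 As] := proj1 (dom s) (ex_intro _ y h).
      by split=> //; apply: List.Forall_impl As => x /sub.
    * by split=> //; apply/FD.
    * case: (classic (List.Forall (sdom G) s)) => As.
        by have [y h] := proj2 (dom s) (conj s0 As); exists y; left.
      by exists (g (code s)); right.
  + move=> s y [/val /sub //|[/= _ Ds _ ->]]; apply/domG'; right.
    by exists (code s); split=> //; exact: codeA.
- by move=> p; left.
- exists ([:: g x0], g (code [:: g x0])); split.
    right; split=> //=; first by apply: one; right; exists x0.
    by case/List.Forall_cons_iff => + _; exact: gA.
  by move=> /val; apply: gA; apply: codeA; apply: one; right; exists x0.
Qed.

(** Compare the domain of a maximal [seq_inj] graph with its complement. If the complement embeds in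
    the domain, [seq_inj_code] codes all words; if the domain embeds in the complement,
    [seq_inj_extend] contradicts maximality. *)
Lemma card_le_seq (X : Type) : card_le nat X -> card_le (seq X) X.
Proof.
move=> [e einj].
have [F FP totF|G [PG Gmax]] := @classical_sets.Zorn_bigcup _ (@seq_inj X).
  split.
  - move=> p q [K FK Kp] [K' FK' K'q].
    have [le|le] := totF _ _ FK FK'; [have [h _ _] := FP _ FK'|have [h _ _] := FP _ FK];
      by apply: h => //; exact: le.
  - move=> s; split=> [[y [K FK Ky]]|[s0 As]].
      have [_ h _] := FP _ FK; have [s0 As] := proj1 (h s) (ex_intro _ y Ky).
      by split=> //; apply: List.Forall_impl As => x [z hz]; exists z, K.
    have [K FK AK] : exists2 K, F K & List.Forall (sdom K) s.
      case: s s0 As => // x s _; elim: s x => [|x' s IH] x /List.Forall_cons_iff [[y [K FK Ky]]].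
        move=> _; exists K => //; apply: List.Forall_cons; first by exists y.
        exact: List.Forall_nil.
      move=> /IH [K' FK' AK']; have [le|le] := totF _ _ FK FK'.
        by exists K' => //; apply: List.Forall_cons => //; exists y; exact: le.
      exists K => //; apply: List.Forall_cons; first by exists y.
      by apply: List.Forall_impl AK' => z [w hw]; exists w; exact: le.
    have [_ h _] := FP _ FK; have [y hy] := proj2 (h s) (conj s0 AK).
    by exists y, K.
  - move=> s y [K FK Ky]; have [_ _ h] := FP _ FK; have [z hz] := h _ _ Ky.
    by exists z, K.
have [[s0 y0] G0] : exists p, G p.
  apply: NNPP => G0.
  (* An empty maximal graph would be properly extended by the countable case, words over the image
     of [e] coded by [pickle]. *)
  apply: (Gmax (fun p => exists l : seq nat, l <> [::] /\ p = (map e l, e (pickle l)))).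
    split; first by move=> p Gp; case: G0; exists p.
    move=> h; apply: G0; exists (map e [:: 0], e (pickle [:: 0])); apply: h.
    by exists [:: 0].
  have dome i : sdom (fun p => exists l : seq nat, l <> [::] /\ p = (map e l, e (pickle l))) (e i).
    by exists (e (pickle [:: i])), [:: i].
  split.
  - move=> _ _ [l [_ ->]] [l' [_ ->]] /=; split=> [/(inj_map einj) -> //|].
    by move=> /einj /(pcan_inj (@pickleK _)) ->.
  - move=> s; split=> [[y [l [l0 [-> _]]]]|[s0 As]].
      split; first by case: l l0.
      by elim: l {l0} => [|i l IH] /=; [exact: List.Forall_nil|apply: List.Forall_cons].
    have [l hl] : exists l, s = map e l.
      elim: s {s0} As => [_|x s IH /List.Forall_cons_iff [[y [l [_ [hx _]]]] /IH [l' ->]]].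
        by exists [::].
      by case: l hx => [|i [|]] //= [->]; exists (i :: l').
    exists (e (pickle l)), l; split; last by rewrite hl.
    by move=> l0; apply: s0; rewrite hl l0.
  - by move=> s y [l [_ [_ ->]]].
have [_ _ val] := PG; have A0 := val _ _ G0.
pose A := {x | sdom G x}; pose A' := {x | ~ sdom G x}.
have [[g ginj]|[g ginj]] := card_le_total A A'; last first.
  pose k x := match excluded_middle_informative (sdom G x) with
    | left _ => x | right h => proj1_sig (g (exist _ x h)) end.
  have [||code [_ cinj]] := seq_inj_code G y0 (fun _ => True) k PG A0.
  - move=> x _ nx; rewrite /k; case: excluded_middle_informative => // h.
    exact: proj2_sig.
  - move=> x x' _ _ nx nx'; rewrite /k.
    case: excluded_middle_informative => // h; case: excluded_middle_informative => // h'.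
    by move=> /sig_inj /ginj [].
  have allT s : List.Forall (fun _ : X => True) s by apply/List.Forall_forall.
  by exists code => s s' h; exact: (cinj _ _ (allT s) (allT s') h).
pose f x := match excluded_middle_informative (sdom G x) with
    | left h => proj1_sig (g (exist _ x h)) | right _ => x end.
have [||G' [PG' sub [p [G'p nGp]]]] := seq_inj_extend G y0 f PG A0.
- move=> x Ax; rewrite /f; case: excluded_middle_informative => // h.
  exact: (proj2_sig (g (exist _ x h))).
- move=> x x' Ax Ax'; rewrite /f.
  case: excluded_middle_informative => // h; case: excluded_middle_informative => // h'.
  by move=> /sig_inj /ginj [].
by case: (Gmax G') => //; split=> // h; apply: nGp; exact: h.
Qed.

Lemma card_le_self_sum (X : Type) : card_le nat X -> card_le (X + X) X.
Proof.
move=> /card_le_seq; apply: card_le_trans.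
exists (fun z : X + X => match z with inl x => [:: x] | inr x => [:: x; x] end).
by move=> [x|x] [y|y] // [->].
Qed.

Lemma card_le_self_prod (X : Type) : card_le nat X -> card_le (X * X) X.
Proof.
move=> /card_le_seq; apply: card_le_trans.
by exists (fun z : X * X => [:: z.1; z.2]) => -[x y] [x' y'] /= [-> ->].
Qed.

Lemma card_lt_max (X Y K : Type) : card_lt X K -> card_lt Y K ->
  exists Z, [/\ card_le X Z, card_le Y Z & card_lt Z K].
Proof.
by have refl := card_le_refl; move=> hX hY; have [h|h] := card_le_total X Y; [exists Y|exists X].
Qed.

Lemma card_lt_sum (X Y K : Type) : card_lt nat K -> card_lt X K -> card_lt Y K ->
  card_lt (X + Y) K.
Proof.
move=> hn /(card_lt_max _ _ _ hn) [Z [nZ XZ /card_lt_max hZ]] /hZ [W [ZW YW WK]].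
apply: card_le_lt_trans WK.
have := card_le_self_sum W (card_le_trans _ _ _ nZ ZW); apply: card_le_trans.
by apply: card_le_sum => //; exact: card_le_trans ZW.
Qed.

(** * Counting formulas and closing under Skolem functions *)

Definition gtree (L : language) : Type := GenTree.tree (nat + (Fsym L + Rsym L)).

(** [GenTree.encode] flattens such trees to words, which [card_le_seq] counts. *)
Fixpoint term_code {L : language} (t : term L) : gtree L :=
  match t with
  | tvar i => GenTree.Leaf (inl i)
  | tapp f ts => GenTree.Node 0 (GenTree.Leaf (inr (inl f)) ::
      [seq term_code (ts i) | i <- enum 'I_(farity f)])
  end.

Fixpoint formula_code {L : language} (phi : formula L) : gtree L :=
  match phi with
  | feq t1 t2 => GenTree.Node 0 [:: term_code t1; term_code t2]
  | Defs.frel r ts => GenTree.Node 1 (GenTree.Leaf (inr (inr r)) ::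
      [seq term_code (ts i) | i <- enum 'I_(rarity r)])
  | fneg p => GenTree.Node 2 [:: formula_code p]
  | fand p q => GenTree.Node 3 [:: formula_code p; formula_code q]
  | fex p => GenTree.Node 4 [:: formula_code p]
  end.

Lemma map_enum_inj {X Y : Type} {k : nat} (c : X -> Y) (a b : 'I_k -> X) :
  (forall i, c (a i) = c (b i) -> a i = b i) ->
  [seq c (a i) | i <- enum 'I_k] = [seq c (b i) | i <- enum 'I_k] -> a = b.
Proof.
move=> h /eq_in_map e; apply: boolp.funext => i; apply: h; apply: e.
by rewrite mem_enum.
Qed.

Lemma term_code_inj (L : language) : injective (@term_code L).
Proof.
elim=> [i|f ts IH] [j|f' ts'] //=; first by case=> ->.
case=> ef; case: f' / ef ts' => ts' /map_enum_inj -> // i; exact: IH.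
Qed.

Lemma formula_code_inj (L : language) : injective (@formula_code L).
Proof.
elim=> [t1 t2|r ts|p IH|p IHp q IHq|p IH] [t1' t2'|r' ts'|p'|p' q'|p'] //=.
- by case=> /term_code_inj -> /term_code_inj ->.
- by case=> er; case: r' / er ts' => ts' /map_enum_inj -> // i; exact: term_code_inj.
- by case=> /IH ->.
- by case=> /IHp -> /IHq ->.
- by case=> /IH ->.
Qed.

Lemma card_le_formula (L : language) (Z : Type) :
  card_le (nat + (Fsym L + Rsym L)) Z -> card_le (formula L) Z.
Proof.
move=> hZ; have nZ : card_le nat Z.
  by apply: card_le_trans hZ; exists inl => i j [].
have /card_le_trans : card_le (formula L) (seq (nat + (nat + (Fsym L + Rsym L)))).
  exists (fun phi => GenTree.encode (formula_code phi)) => phi psi.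
  by move=> /(pcan_inj (@GenTree.codeK _)) /formula_code_inj.
apply; apply: card_le_trans (card_le_seq Z nZ); apply: card_le_map_seq.
by apply: card_le_trans (card_le_self_sum Z nZ); exact: card_le_sum.
Qed.

(** The hull is built in levels, each parametrized by [Z] itself: a code in [Z] stands for an
    element of the previous level or for an operation applied to a word over it. Hence the hull is
    an image of [nat * Z]. *)
Lemma skolem_closure (F X Z : Type) (W : F -> seq X -> X) (B : X -> Prop) (b0 : X) :
  card_le nat Z -> card_le F Z -> card_le {x | B x} Z -> B b0 ->
  exists M : X -> Prop, [/\ forall x, B x -> M x,
    forall phi s, List.Forall M s -> M (W phi s) & card_le {x | M x} Z].
Proof.
move=> nZ FZ [b binj] Bb0.
have [c cinj] : card_le (Z + F * seq Z) Z.
  apply: card_le_trans (card_le_self_sum Z nZ); apply: card_le_sum; first exact: card_le_refl.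
  apply: card_le_trans (card_le_self_prod Z nZ); apply: card_le_prod => //.
  exact: card_le_seq.
have exd z : exists w, forall w', c w' = z -> w' = w.
  case: (classic (exists w, c w = z)) => [[w hw]|no].
    by exists w => w'; rewrite -hw => /cinj.
  by exists (inl z) => w' h; case: no; exists w'.
have [d hd] := boolp.choice exd.
have exb z : exists x, forall y : {x | B x}, b y = z -> proj1_sig y = x.
  case: (classic (exists y, b y = z)) => [[w hw]|no].
    by exists (proj1_sig w) => w'; rewrite -hw => /binj ->.
  by exists b0 => w' h; case: no; exists w'.
have [b' hb'] := boolp.choice exb.
pose lev := fix lev (k : nat) (z : Z) : X :=
  if k is k'.+1 then
    match d z with inl z' => lev k' z' | inr p => W p.1 (map (lev k') p.2) end
  else b' z.
have levS k z : exists z', lev k.+1 z' = lev k z.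
  by exists (c (inl z)) => /=; rewrite -(hd _ (inl z) erefl).
have lev_le k k' z : (k <= k')%N -> exists z', lev k' z' = lev k z.
  elim: k' => [|k' IH]; first by rewrite leqn0 => /eqP ->; exists z.
  rewrite leq_eqVlt => /orP [/eqP ->|]; first by exists z.
  by rewrite ltnS => /IH [z' <-]; exact: levS.
pose M x := exists p : nat * Z, lev p.1 p.2 = x.
exists M; split.
- by move=> x Bx; exists (0, b (exist _ x Bx)); rewrite /= -(hb' _ (exist _ x Bx) erefl).
- move=> phi s Ms.
  (* The levels increase, so the finitely many letters of [s] share one. *)
  have [k [t ht]] : exists k t, map (lev k) t = s.
    elim: s Ms => [|x s IH]; first by exists 0, [::].
    move=> /List.Forall_cons_iff [[[k z] /= hz] /IH [k' [t ht]]].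
    exists (maxn k k').
    have [z' hz'] := lev_le k (maxn k k') z (leq_maxl _ _).
    have [t' ht'] : exists t', map (lev (maxn k k')) t' = s.
      rewrite -ht; elim: t {ht} => [|w t [t' IHt]]; first by exists [::].
      have [w' hw'] := lev_le k' (maxn k k') w (leq_maxr _ _).
      by exists (w' :: t'); rewrite /= hw' IHt.
    by exists (z' :: t'); rewrite /= hz' ht' hz.
  exists (k.+1, c (inr (phi, t))) => /=.
  by rewrite -(hd _ (inr (phi, t)) erefl) /= ht.
- apply: card_le_trans (card_le_self_prod Z nZ).
  apply: (card_le_trans _ (nat * Z)); last by apply: card_le_prod => //; exact: card_le_refl.
  apply: (card_le_graph _ _ (fun x p => lev p.1 p.2 = proj1_sig x)).
    by move=> [x [p hp]]; exists p.
  by move=> x x' p e e'; apply: sig_inj; rewrite -e -e'.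
Qed.

Lemma teval_substructure {L : language} {U : structure L} {M : U -> Prop}
    (m0 : U) (h0 : M m0) (hcl : Defs.fclosed M) (t : term L) (e : nat -> substructure h0 hcl) :
  proj1_sig (teval (substructure h0 hcl) e t) = teval U (fun i => proj1_sig (e i)) t.
Proof.
elim: t => [i|f ts IH] //=; congr (finterp U f _).
by apply: boolp.funext => i; exact: IH.
Qed.

Lemma tarski_vaught {L : language} {U : structure L} {M : U -> Prop}
    (m0 : U) (h0 : M m0) (hcl : Defs.fclosed M) :
  (forall p (e : nat -> U), (forall i, M (e i)) -> (exists u, sat U (scons u e) p) ->
     exists2 u, M u & sat U (scons u e) p) ->
  elem_sub M.
Proof.
move=> tv; exists m0, h0, hcl; set S := substructure h0 hcl.
elim=> [t1 t2|r ts|p IH|p IHp q IHq|p IH] e /=.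
- rewrite -!teval_substructure; split=> [-> //|]; exact: sig_inj.
- suff -> : (fun i => proj1_sig (teval S e (ts i)))
    = (fun i => teval U (fun i => proj1_sig (e i)) (ts i)) by [].
  by apply: boolp.funext => i; exact: teval_substructure.
- by have := IH e; tauto.
- by have := IHp e; have := IHq e; tauto.
- have E (u : S) : (fun i => proj1_sig (scons u e i))
      = scons (proj1_sig u) (fun i => proj1_sig (e i)).
    by apply: boolp.funext => -[].
  split=> [[u /IH]|h]; first by rewrite E; exists (proj1_sig u).
  have [|u Mu hu] := tv p (fun i => proj1_sig (e i)) _ h.
    by move=> i; exact: proj2_sig.
  by exists (exist _ u Mu); apply/IH; rewrite E.
Qed.

Lemma lowenheim_skolem {L : language} {U : structure L} (K : Type) (B : U -> Prop) (b0 : U) :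
  card_lt (nat + (Fsym L + Rsym L)) K -> small K B -> B b0 ->
  exists M : U -> Prop, [/\ small K M, elem_sub M & forall x, B x -> M x].
Proof.
move=> LK BK Bb0; have [Z [LZ BZ ZK]] := card_lt_max _ _ _ LK BK.
have nZ : card_le nat Z by apply: card_le_trans LZ; exists inl => i j [].
pose W (p : formula L) (s : seq U) : U :=
  epsilon (inhabits b0) (fun u => sat U (scons u (nth b0 s)) p).
have specW p s u : sat U (scons u (nth b0 s)) p -> sat U (scons (W p s) (nth b0 s)) p.
  move=> h; exact: (epsilon_spec (inhabits b0)
    (fun u => sat U (scons u (nth b0 s)) p) (ex_intro _ u h)).
have [M [BM WM MZ]] := skolem_closure _ U Z W B b0 nZ (card_le_formula L Z LZ) BZ Bb0.
exists M; split=> //; first exact: card_le_lt_trans MZ ZK.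
have hcl : Defs.fclosed M.
  move=> f args hargs.
  pose s := [seq args i | i <- enum 'I_(farity f)].
  have nthE i : nth b0 s (nat_of_ord i) = args i.
    by rewrite (nth_map i) ?size_enum_ord // nth_ord_enum.
  have As : List.Forall M s.
    by rewrite /s; elim: (enum _) => [|i l IH]; [exact: List.Forall_nil|apply: List.Forall_cons].
  (* Closure under [f] is an instance of closure under witnesses: the only solution of this equation
     is the value of [f]. *)
  pose p : formula L := feq (tvar 0) (tapp (fun i : 'I_(farity f) => tvar (nat_of_ord i).+1)).
  have argsE : (fun i => nth b0 s (nat_of_ord i)) = args by exact: boolp.funext.
  have : sat U (scons (W p s) (nth b0 s)) p.
    by apply: (specW _ _ (finterp U f args)); rewrite /= argsE.
  by rewrite /= argsE => <-; exact: WM.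
apply: (tarski_vaught b0 (BM _ Bb0) hcl) => p e Me [u hu].
(* Only finitely many variables of [p] matter, so the environment is cut to a word to which [W]
   applies. *)
have [N hN] := ffv_lt_ex p; pose s := mkseq e N.
have eqe v : sat U (scons v e) p <-> sat U (scons v (nth b0 s)) p.
  by apply: sat_eq_in hN _ => -[|i] //= hi; rewrite nth_mkseq //; exact: ltnW.
exists (W p s).
  apply: WM; rewrite /s /mkseq.
  by elim: iota => [|i l IH]; [exact: List.Forall_nil|apply: List.Forall_cons].
by apply/eqe/(specW _ _ u)/eqe.
Qed.

Theorem theorem4p12 (L : language) (U : structure L) (K : Type)
  (hU : monster U K) (n m : nat)
  (mu : (('I_n -> U) -> Prop) -> R) (nu : (('I_m -> U) -> Prop) -> R)
  (hmu : is_kmeasure (allS U) mu) (hnu : is_kmeasure (allS U) nu) :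
  (forall M : U -> Prop, small K M -> elem_sub M ->
     fin_sat_in mu M -> geE_at M mu nu -> fin_sat_in nu M) /\
  (fin_sat K mu -> geE K mu nu -> fin_sat K nu).
Proof.
split=> [M _ hM hfs hge|[M [MK [hM hfs]]] [A [AK hge]]].
  exact: (fin_sat_in_geE_at mu nu hM (fun _ h => h) hmu hfs hge).
have [LK _] := hU; have [m0 [Mm0 _]] := hM.
have nK : card_lt nat K by apply: card_le_lt_trans LK; exists inl => i j [].
have BK : small K (fun x => M x \/ A x).
  apply: card_le_lt_trans (card_lt_sum _ _ _ nK MK AK).
  apply: (card_le_graph _ _ (fun x (y : {x | M x} + {x | A x}) =>
    match y with inl z => proj1_sig z | inr z => proj1_sig z end = proj1_sig x)).
    move=> [x [h|h]]; first by exists (inl (exist _ x h)).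
    by exists (inr (exist _ x h)).
  by move=> x x' y e e'; apply: sig_inj; rewrite -e -e'.
(* [N] contains [M], so that [mu] stays finitely satisfiable in it, and [A], over which domination
   is witnessed. *)
have [N [NK hN BN]] := lowenheim_skolem K _ m0 LK BK (or_introl Mm0).
have Nfs : fin_sat_in mu N.
  move=> D hD /(hfs D hD) [a [Ma Da]]; exists a; split=> // i.
  by apply: BN; left.
exists N; split=> //; split=> //.
by apply: (fin_sat_in_geE_at mu nu hN _ hmu Nfs hge) => x Ax; apply: BN; right.
Qed.
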